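(* Let $(M,\Omega,\mathbb{T},\mu)$ be a compact toric symplectic manifold of dimension $2n$ and let $\mathbb{J}_1\in GK_\Omega^{\mathbb{T}}(M)$, i.e. $\mathbb{J}_1$ is the generalized complex structure associated to some $J_+\in GK_\Omega^{\mathbb{T}}(M)$, with associated matrices $F$ and $\phi_a$. Then all points in $\mathring M$ are regular for $\mathbb{J}_1$, and the common type is the co-rank of the complex $n\times n$ matrix $F/2-\sqrt{-1}\,\phi_a$.
   Context: Setting. A compact toric symplectic manifold $(M,\Omega,\mathbb{T},\mu)$ of dimension $2n$ is a compact symplectic manifold with an effective Hamiltonian action of $\mathbb{T}=\mathbb{T}^n$ (Lie algebra $\mathfrak{t}$) and moment map $\mu:M\to\mathfrak{t}^*$. $\Delta=\mu(M)$ is the moment polytope, $\mathring{\Delta}$ its interior, $\mathring{M}=\mu^{-1}(\mathring{\Delta})$. Fix a basis $\{e_j\}$ of $\mathfrak{t}$; $X_j$ is the fundamental vector field of $e_j$, $\mu_j$ the components of $\mu$. The sign convention is such that $\Omega=\sum_j d\mu_j\wedge d\theta_j$ in local Darboux coordinates on $\mathring M$ with $X_j=\partial_{\theta_j}$. Two-forms are regarded as maps $X\mapsto\Omega(X,\cdot)$; $A^*\alpha=\alpha\circ A$; $\zeta^\pm$, $d\mu$ are columns of 1-forms. For a matrix $\phi$, $\phi_s$ and $\phi_a$ are its symmetric and anti-symmetric parts. $GK_\Omega^{\mathbb{T}}(M)$ is the set of $\mathbb{T}$-invariant integrable complex structures $J_+$ on $M$ tamed by $\Omega$ ($\Omega(X,J_+X)>0$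 for $X\neq0$) whose symplectic adjoint $J_-:=-\Omega^{-1}J_+^*\Omega$ is also integrable. For such $J_+$, $g=-\frac12\Omega(J_++J_-)$ is a Riemannian metric, $\omega_\pm=gJ_\pm$, and $$\mathbb{J}_1=\frac12\begin{pmatrix}-J_+-J_-&\omega_+^{-1}-\omega_-^{-1}\\-\omega_++\omega_-&J_+^*+J_-^*\end{pmatrix}$$ on $TM\oplus T^*M$ (metric splitting); its associated real Poisson structure is $\beta_1=-\frac12(J_+-J_-)g^{-1}$. The type of $\mathbb{J}_1$ at a point $p$ is the complex dimension transverse to the symplectic leaf of $\beta_1$ through $p$, i.e. $n-\frac12\operatorname{rank}_{\mathbb{R}}\beta_1(p)$; $p$ is regular if the type is constant near $p$. Associated data (known facts). Let $\{\zeta_j^\pm,\vartheta_j^\pm\}$ be the coframe on $\mathring M$ dual to $\{X_j,J_\pm X_j\}$. There are a matrix-valued function $\phi=\phi(\mu)$ on $\mathring\Delta$ and a constant anti-symmetric real matrix $F$ with $J_+^*\zeta^+=\phi^T d\mu$, $J_-^*\zeta^-=\phi\,d\mu$ and $\zeta^-=\zeta^++F\,d\mu$. Moreover $\phi_a$ is a constant matrix and $\phi_s$ is the Hessian of a strictly convex function on $\mathring\Delta$. The co-rank of an $n\times n$ matrix $A$ is $n-\operatorname{rk}A$. *)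

(* Defs.v *)
From HB Require Import structures.
From mathcomp Require Import all_boot all_order all_algebra.
From mathcomp Require Import all_classical all_reals all_analysis.
From mathcomp Require Import complex.

Set Implicit Arguments.
Unset Strict Implicit.
Unset Printing Implicit Defensive.

Import Order.TTheory GRing.Theory Num.Theory.
Import numFieldNormedType.Exports.

Local Open Scope classical_set_scope.
Local Open Scope ring_scope.

(* Points of R^m, tangent vectors and elements of the Lie algebra are columns;
   a covector is a row, and a column of k 1-forms is a k x m matrix.  Tensor
   fields are given classically, by their components in every chart. *)

Fixpoint Ck_on (R : realType) (V W : normedModType R) (k : nat)
    (U : set V) (f : V -> W) : Prop :=
  match k with
  | 0 => forall x, U x -> {for x, continuous f}
  | k'.+1 => (forall x, U x -> differentiable f x) /\
             (forall v : V, Ck_on k' U (fun x => 'D_v f x))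
  end.

(* Meaningful for open U. *)
Definition smooth_on (R : realType) (V W : normedModType R)
    (U : set V) (f : V -> W) : Prop := forall k, Ck_on k U f.

Definition jacobian_mx (R : realType) (m k : nat)
    (f : 'cV[R]_m -> 'cV[R]_k) (x : 'cV[R]_m) : 'M[R]_(k, m) :=
  \matrix_(a < k, b < m) ('D_(delta_mx b 0) f x) a 0.

Record chart (R : realType) (m : nat) (M : topologicalType) := Chart {
  dom : set M;
  cod : set 'cV[R]_m;
  fwd : M -> 'cV[R]_m;
  inv : 'cV[R]_m -> M;
  chart_open_dom : open dom;
  chart_open_cod : open cod;
  chart_fwd : forall p, dom p -> cod (fwd p);
  chart_inv : forall x, cod x -> dom (inv x);
  chart_fwdK : forall p, dom p -> inv (fwd p) = p;
  chart_invK : forall x, cod x -> fwd (inv x) = x;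
  chart_fwd_continuous : forall p, dom p -> {for p, continuous fwd};
  chart_inv_continuous : forall x, cod x -> {for x, continuous inv} }.

Record manifold (R : realType) (m : nat) := Manifold {
  space :> topologicalType;
  chart_index : Type;
  ch : chart_index -> chart R m space;
  chart_at : space -> chart_index;
  chart_atP : forall p, dom (ch (chart_at p)) p;
  manifold_hausdorff : hausdorff_space space;
  manifold_second_countable : @second_countable space;
  manifold_compat : forall i j,
    smooth_on (cod (ch i) `&` inv (ch i) @^-1` dom (ch j))
              (fwd (ch j) \o inv (ch i)) }.

(* [T i p] : components at p, in the chart i, of a tensor whose components form
   an element of E; only relevant when p belongs to the domain of i. *)
Definition tensor_field (R : realType) (m : nat) (M : manifold R m)
    (E : Type) :=
  chart_index M -> M -> E.

Definition smooth_field (R : realType) (m : nat) (M : manifold R m)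
    (E : normedModType R) (T : tensor_field M E) : Prop :=
  forall i, smooth_on (cod (ch i)) (T i \o inv (ch i)).

(* The differential at p of f : M -> M, in the charts i (around p) and j
   (around f p). *)
Definition diff_mx (R : realType) (m : nat) (M : manifold R m) (f : M -> M)
    (i j : chart_index M) (p : M) : 'M[R]_m :=
  jacobian_mx (fwd (ch j) \o f \o inv (ch i)) (fwd (ch i) p).

(* Endomorphism fields are given by their matrices, bilinear forms by their
   Gram matrices: w(u, v) = u^T W v.  The next two definitions say that f
   preserves the tensor; for f = id they are the transformation laws under
   changes of charts. *)
Definition preserves_endo (R : realType) (m : nat) (M : manifold R m)
    (f : M -> M) (J : tensor_field M 'M[R]_m) : Prop :=
  forall i j p, dom (ch i) p -> dom (ch j) (f p) ->
    J j (f p) *m diff_mx f i j p = diff_mx f i j p *m J i p.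

Definition preserves_form (R : realType) (m : nat) (M : manifold R m)
    (f : M -> M) (W : tensor_field M 'M[R]_m) : Prop :=
  forall i j p, dom (ch i) p -> dom (ch j) (f p) ->
    W i p = (diff_mx f i j p)^T *m W j (f p) *m diff_mx f i j p.

(* d(omega)(u, v, w) = 0 for constant coordinate vector fields u, v, w. *)
Definition closed_form (R : realType) (m : nat) (M : manifold R m)
    (W : tensor_field M 'M[R]_m) : Prop :=
  forall i x, cod (ch i) x -> forall u v w : 'cV[R]_m,
    let Wc := W i \o inv (ch i) in
    v^T *m 'D_u Wc x *m w + w^T *m 'D_v Wc x *m u + u^T *m 'D_w Wc x *m v = 0.

Record symplectic_form (R : realType) (m : nat) (M : manifold R m)
    (W : tensor_field M 'M[R]_m) : Prop := SymplecticForm {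
  symplectic_tensor : preserves_form (fun p : M => p) W;
  symplectic_smooth : smooth_field W;
  symplectic_skew : forall i p, dom (ch i) p -> (W i p)^T = - W i p;
  symplectic_nondegenerate : forall i p, dom (ch i) p -> W i p \in unitmx;
  symplectic_closed : closed_form W }.

Definition lie_bracket (R : realType) (m : nat)
    (X Y : 'cV[R]_m -> 'cV[R]_m) (x : 'cV[R]_m) : 'cV[R]_m :=
  'D_(X x) Y x - 'D_(Y x) X x.

(* Vanishing of the Nijenhuis tensor. *)
Definition integrable_endo (R : realType) (m : nat) (M : manifold R m)
    (J : tensor_field M 'M[R]_m) : Prop :=
  forall i (X Y : 'cV[R]_m -> 'cV[R]_m),
    smooth_on (cod (ch i)) X -> smooth_on (cod (ch i)) Y ->
    let Jc := J i \o inv (ch i) in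
    let JX := fun x => Jc x *m X x in
    let JY := fun x => Jc x *m Y x in
    forall x, cod (ch i) x ->
      lie_bracket JX JY x - Jc x *m lie_bracket JX Y x
      - Jc x *m lie_bracket X JY x - lie_bracket X Y x = 0.

Record integrable_complex_structure (R : realType) (m : nat)
    (M : manifold R m) (J : tensor_field M 'M[R]_m) : Prop :=
  IntegrableComplexStructure {
    complex_tensor : preserves_endo (fun p : M => p) J;
    complex_smooth : smooth_field J;
    complex_square : forall i p, dom (ch i) p -> J i p *m J i p = - 1%:M;
    complex_integrable : integrable_endo J }.

(* The differential of a map M -> R^k, as a column of k 1-forms. *)
Definition dform (R : realType) (m k : nat) (M : manifold R m)
    (f : M -> 'cV[R]_k) : tensor_field M 'M[R]_(k, m) :=
  fun i p => jacobian_mx (f \o inv (ch i)) (fwd (ch i) p).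

(* Fundamental vector fields of an action of R^n: the j-th column is
   X_j(p) = d/dt (t e_j . p) at t = 0. *)
Definition fundamental_fields (R : realType) (m n : nat) (M : manifold R m)
    (act : 'cV[R]_n -> M -> M) : tensor_field M 'M[R]_(m, n) :=
  fun i p => jacobian_mx (fun v => fwd (ch i) (act v p)) 0.

(* The Lie algebra t is identified with R^n by the chosen basis e_j, and its
   dual with R^n by the dual basis.  The torus is t / L, with L the lattice
   spanned by the columns of [lattice]; an effective action of the torus is an
   action of t whose kernel is exactly L. *)
Record toric_manifold (R : realType) (n : nat) := ToricManifold {
  toric_base :> manifold R n.*2;
  toric_compact : compact [set: toric_base];
  toric_connected : connected [set: toric_base];
  Omega : tensor_field toric_base 'M[R]_(n.*2);
  toric_symplectic : symplectic_form Omega;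
  lattice : 'M[R]_n;
  lattice_full : lattice \in unitmx;
  act : 'cV[R]_n -> toric_base -> toric_base;
  act0 : forall p, act 0 p = p;
  actD : forall u v p, act (u + v) p = act u (act v p);
  act_effective : forall v,
    (forall p, act v p = p) <->
    exists k : 'cV[int]_n, v = lattice *m map_mx intr k;
  act_continuous :
    continuous (fun q : 'cV[R]_n * toric_base => act q.1 q.2);
  act_smooth : forall i j,
    smooth_on
      [set q : 'cV[R]_n * 'cV[R]_(n.*2) |
         cod (ch i) q.2 /\ dom (ch j) (act q.1 (inv (ch i) q.2))]
      (fun q => fwd (ch j) (act q.1 (inv (ch i) q.2)));
  act_symplectic : forall v, preserves_form (act v) Omega;
  mu : toric_base -> 'cV[R]_n;
  mu_smooth : forall i, smooth_on (cod (ch i)) (mu \o inv (ch i));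
  mu_invariant : forall v p, mu (act v p) = mu p;
  (* Omega(X_j, .) = - d mu_j, the sign for which
     Omega = sum_j d mu_j /\ d theta_j when X_j = d/d theta_j. *)
  mu_moment : forall i p, dom (ch i) p ->
    (fundamental_fields act i p)^T *m Omega i p = - dform mu i p }.

Definition moment_polytope (R : realType) (n : nat) (M : toric_manifold R n) :
  set 'cV[R]_n := range (@mu R n M).

Definition polytope_interior (R : realType) (n : nat)
  (M : toric_manifold R n) : set 'cV[R]_n := interior (moment_polytope M).

Definition open_stratum (R : realType) (n : nat) (M : toric_manifold R n) :
  set M := @mu R n M @^-1` polytope_interior M.

(* From here to J1_mx, W is the Gram matrix of Omega at a point, and all other
   matrices represent linear maps between the tangent and cotangent spaces in
   terms of columns of coordinates, so that A^* is A^T. *)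

(* The matrix of X |-> w(X, .) when W is the Gram matrix of w. *)
Definition flat_mx (R : realType) (m : nat) (W : 'M[R]_m) : 'M[R]_m := W^T.

Definition Jminus_mx (R : realType) (m : nat) (W Jp : 'M[R]_m) : 'M[R]_m :=
  - (invmx (flat_mx W) *m Jp^T *m flat_mx W).

Definition metric_mx (R : realType) (m : nat) (W Jp : 'M[R]_m) : 'M[R]_m :=
  - 2^-1 *: (flat_mx W *m (Jp + Jminus_mx W Jp)).

Definition J1_mx (R : realType) (m : nat) (g Jp Jm : 'M[R]_m) :
    'M[R]_(m + m) :=
  let wp := g *m Jp in
  let wm := g *m Jm in
  2^-1 *: block_mx (- Jp - Jm) (invmx wp - invmx wm)
                   (- wp + wm) (Jp^T + Jm^T).

(* The real Poisson structure of a generalized complex structure, as a map from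
   the cotangent space to the tangent space. *)
Definition poisson_mx (R : realType) (m : nat) (JJ : 'M[R]_(m + m)) : 'M[R]_m :=
  ursubmx JJ.

Lemma poisson_J1_mx (R : realType) (m : nat) (g Jp Jm : 'M[R]_m) :
  g \in unitmx -> Jp *m Jp = - 1%:M -> Jm *m Jm = - 1%:M ->
  poisson_mx (J1_mx g Jp Jm) = - 2^-1 *: ((Jp - Jm) *m invmx g).
Proof.
move=> gU Jp2 Jm2.
have invgJ (J : 'M[R]_m) : J *m J = - 1%:M ->
    invmx (g *m J) = - (J *m invmx g).
  move=> J2.
  have gJK : (- (J *m invmx g)) *m (g *m J) = 1%:M.
    by rewrite mulNmx mulmxA -(mulmxA J) mulVmx // mulmx1 J2 opprK.
  have gJU : g *m J \in unitmx by case/mulmx1_unit: gJK.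
  by rewrite -[RHS]mulmx1 -(mulmxV gJU) mulmxA gJK mul1mx.
rewrite /poisson_mx /J1_mx scale_block_mx block_mxKur !invgJ // mulmxBl.
by rewrite opprK scaleNr -scalerN opprB addrC.
Qed.

Definition Jminus (R : realType) (n : nat) (M : toric_manifold R n)
    (Jp : tensor_field M 'M[R]_(n.*2)) : tensor_field M 'M[R]_(n.*2) :=
  fun i p => Jminus_mx (@Omega R n M i p) (Jp i p).

(* J_+ belongs to GK_Omega^T(M). *)
Record GK (R : realType) (n : nat) (M : toric_manifold R n)
    (Jp : tensor_field M 'M[R]_(n.*2)) : Prop := MkGK {
  GK_plus : integrable_complex_structure Jp;
  GK_invariant : forall v, preserves_endo (@act R n M v) Jp;
  GK_tamed : forall i p, dom (ch i) p -> forall u : 'cV[R]_(n.*2), u != 0 ->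
    0 < (u^T *m @Omega R n M i p *m (Jp i p *m u)) 0 0;
  GK_minus : integrable_complex_structure (Jminus Jp) }.

Definition J1 (R : realType) (n : nat) (M : toric_manifold R n)
    (Jp : tensor_field M 'M[R]_(n.*2)) : tensor_field M 'M[R]_(n.*2 + n.*2) :=
  fun i p => J1_mx (metric_mx (@Omega R n M i p) (Jp i p))
                   (Jp i p) (Jminus Jp i p).

(* Rational-valued, so that neither the halving nor the difference truncates.
   The rank does not depend on the chart. *)
Definition gc_type (R : realType) (n : nat) (M : toric_manifold R n)
    (JJ : tensor_field M 'M[R]_(n.*2 + n.*2)) (p : M) : rat :=
  n%:R - (\rank (poisson_mx (JJ (chart_at p) p)))%:R / 2.

Definition regular_point (R : realType) (n : nat) (M : toric_manifold R n)
    (JJ : tensor_field M 'M[R]_(n.*2 + n.*2)) (p : M) : Prop :=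
  \forall q \near p, gc_type JJ q = gc_type JJ p.

Definition sym_part (R : realType) (n : nat) (A : 'M[R]_n) : 'M[R]_n :=
  2^-1 *: (A + A^T).

Definition asym_part (R : realType) (n : nat) (A : 'M[R]_n) : 'M[R]_n :=
  2^-1 *: (A - A^T).

(* The rows of zeta and theta form, on the open stratum, the coframe dual to
   the frame X_1, .., X_n, J X_1, .., J X_n. *)
Definition dual_coframe (R : realType) (n : nat) (M : toric_manifold R n)
    (J : tensor_field M 'M[R]_(n.*2))
    (zeta theta : tensor_field M 'M[R]_(n, n.*2)) : Prop :=
  forall i p, dom (ch i) p -> open_stratum p ->
    let X := fundamental_fields (@act R n M) i p in
    [/\ zeta i p *m X = 1%:M, zeta i p *m (J i p *m X) = 0,
        theta i p *m X = 0 & theta i p *m (J i p *m X) = 1%:M].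

Definition strictly_convex_on (R : realType) (n : nat) (D : set 'cV[R]_n)
    (f : 'cV[R]_n -> R) : Prop :=
  forall x y, D x -> D y -> x != y -> forall t : R, 0 < t -> t < 1 ->
    f (t *: x + (1 - t) *: y) < t * f x + (1 - t) * f y.

Definition hessian_mx (R : realType) (n : nat) (f : 'cV[R]_n -> R)
    (x : 'cV[R]_n) : 'M[R]_n :=
  \matrix_(a < n, b < n)
    'D_(delta_mx a 0) (fun y => 'D_(delta_mx b 0) f y) x.

(* phi and F are the matrices associated to J_+, and phia is the constant
   anti-symmetric part of phi. *)
Record associated_data (R : realType) (n : nat) (M : toric_manifold R n)
    (Jp : tensor_field M 'M[R]_(n.*2)) (phi : 'cV[R]_n -> 'M[R]_n)
    (F phia : 'M[R]_n) : Prop := AssociatedData {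
  data_F_skew : F^T = - F;
  data_coframes : exists zp tp zm tm : tensor_field M 'M[R]_(n, n.*2),
    [/\ dual_coframe Jp zp tp, dual_coframe (Jminus Jp) zm tm &
        forall i p, dom (ch i) p -> open_stratum p ->
          let dmu := dform (@mu R n M) i p in
          [/\ zp i p *m Jp i p = (phi (mu p))^T *m dmu,
              zm i p *m Jminus Jp i p = phi (mu p) *m dmu &
              zm i p = zp i p + F *m dmu]];
  data_phia : forall x, polytope_interior M x -> asym_part (phi x) = phia;
  data_phis : exists tau : 'cV[R]_n -> R,
    [/\ smooth_on (polytope_interior M) tau,
        strictly_convex_on (polytope_interior M) tau &
        forall x, polytope_interior M x ->
          sym_part (phi x) = hessian_mx tau x] }.

(* F / 2 - sqrt(-1) phia *)
Definition type_mx (R : realType) (n : nat) (F phia : 'M[R]_n) :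
    'M[R[i]]_n :=
  map_mx (real_complex R) (2^-1 *: F) - 'i%C *: map_mx (real_complex R) phia.

Definition corank (K : fieldType) (n : nat) (A : 'M[K]_n) : nat :=
  (n - \rank A)%N.

(* Main.v *)
Require Import Defs.
From mathcomp Require Import all_boot all_order all_algebra.
From mathcomp Require Import all_classical all_reals all_analysis.
From mathcomp Require Import complex.

Import Order.TTheory GRing.Theory Num.Theory.
Import numFieldNormedType.Exports.

Local Open Scope classical_set_scope.
Local Open Scope ring_scope.

(** In well-chosen coframes J_+ - J_- has constant coefficients.  Fix a point
    of the open stratum, and let dmu be the column of 1-forms d mu_j there.
    From zeta^+ J_+ = phi^T dmu, zeta^- J_- = phi dmu,
    zeta^- = zeta^+ + F dmu and J_+^2 = J_-^2 = -1 one reads off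
<<
      zeta^-     (J_+ - J_-) = F (dmu J_+) - (phi - phi^T) dmu
      zeta^- J_- (J_+ - J_-) = (phi - phi^T) (dmu J_+) + F dmu.
>>
    Both (zeta^-, zeta^- J_-) and (dmu J_+, dmu) are bases of the cotangent
    space ([coframe_row_free] and [moment_coframe_row_free]), so J_+ - J_- has
    the rank of the real block matrix with rows (F, - 2 phi_a) and (2 phi_a, F)
    ([rank_diff]).  This block matrix is the realification of F + 2 i phi_a,
    whose real rank is twice its complex rank ([rank_realification]), and
    passing to the conjugate and to a nonzero multiple leaves F / 2 - i phi_a.
    Since beta_1 is J_+ - J_- composed with the invertible g^-1, the type is
    the corank of F / 2 - i phi_a.  As F and phi_a are constant and the open
    stratum is open, every point there is regular. *)

(** * Real and complex ranks *)

(** Over the complex numbers, (1, i) and (1, -i) split the realification of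
    A + i B into A + i B and its conjugate, which have the same rank. *)
Lemma rank_realification (R : realType) (n : nat) (A B : 'M[R]_n) :
  \rank (block_mx A (- B) B A) =
  (\rank (map_mx (real_complex R) A - 'i%C *: map_mx (real_complex R) B)).*2.
Proof.
set A' := map_mx _ A; set B' := map_mx _ B.
have i2 : 'i%C * 'i%C = -1 :> R[i] by rewrite -expr2 sqr_i.
have rank_conj : \rank (A' + 'i%C *: B')%R = \rank (A' - 'i%C *: B').
  rewrite -(mxrank_map (conjc : {rmorphism R[i] -> R[i]})).
  congr (\rank _); apply/matrixP => i j; rewrite !mxE /=.
  by apply/eqP; rewrite eq_complex /= !mul0r !mul1r
    !(mulr0, subr0, sub0r, add0r, addr0, oppr0) !eqxx.
rewrite -(mxrank_map (real_complex R)) map_block_mx map_mxN -/A' -/B'.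
pose U : 'M[R[i]]_(n + n) :=
  block_mx 1%:M ('i%C)%:M 1%:M (- 'i%C)%:M.
pose V : 'M[R[i]]_(n + n) :=
  block_mx 1%:M 1%:M (- 'i%C)%:M ('i%C)%:M.
have UV : U *m (2^-1 *: V) = 1%:M.
  rewrite -scalemxAr mulmx_block !mul1mx -!scalar_mxM !mulrN !mulNr !i2.
  rewrite !opprK -!(raddfD (@scalar_mx _ n)) /= subrr raddf0.
  rewrite scale_block_mx !scaler0 !scale_scalar_mx mulVf ?pnatr_eq0 //.
  by rewrite -scalar_mx_block.
have [Uu _] := mulmx1_unit UV.
have split_block : U *m block_mx A' (- B') B' A' =
    block_mx (A' + 'i%C *: B') 0 0 (A' - 'i%C *: B') *m U.
  rewrite !mulmx_block !mul1mx !mulmx1 !mul0mx !addr0 !add0r.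
  rewrite !mul_scalar_mx !mul_mx_scalar !scalerDr !scalerN !scaleNr !scalerA.
  by rewrite i2 !scaleN1r !opprK [- B' + _]addrC [- B' - _]addrC.
rewrite -(eqmxMfull _ (_ : row_full U)) ?row_full_unit // split_block.
by rewrite mxrankMfree ?row_free_unit // rank_diag_block_mx rank_conj addnn.
Qed.

Lemma posdef_unitmx (R : realType) (m : nat) (g : 'M[R]_m) :
  (forall u : 'cV[R]_m, u != 0 -> 0 < (u^T *m (g *m u)) 0 0) -> g \in unitmx.
Proof.
move=> gpos; rewrite -unitmx_tr -row_free_unit -kermx_eq0.
apply/rowV0P => v /sub_kermxP vg0; apply/eqP/negPn/negP => v0.
have := gpos v^T; rewrite trmx_eq0 trmxK v0 => /(_ isT).
by rewrite -[g]trmxK -trmx_mul vg0 trmx0 mulmx0 mxE ltxx.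
Qed.

(** * Linear algebra at a point *)

Section Coframes.
Context {K : fieldType} {n m : nat}.
Implicit Types (J : 'M[K]_m) (X : 'M[K]_(m, n)) (zeta dmu : 'M[K]_(n, m)).

(** These 1-forms are dual to the vectors (X, - J X), since J^2 = - 1. *)
Lemma coframe_row_free {J X zeta} :
  J *m J = - 1%:M -> zeta *m X = 1%:M -> zeta *m (J *m X) = 0 ->
  row_free (col_mx zeta (zeta *m J)).
Proof.
move=> J2 zX zJX; apply/row_freeP; exists (row_mx X (- (J *m X))).
rewrite mul_col_row !mulmxN -!mulmxA zX zJX oppr0 (mulmxA J J) J2.
by rewrite mulNmx mul1mx mulmxN opprK zX -scalar_mx_block.
Qed.

(** The matrix psi maps (dmu J, dmu) to (- zeta, zeta J), and these forms are
    independent; so psi is automatically invertible and dmu, dmu J are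
    independent as well. *)
Lemma moment_coframe_row_free {J X zeta dmu} {psi : 'M[K]_n} :
  J *m J = - 1%:M -> zeta *m X = 1%:M -> zeta *m (J *m X) = 0 ->
  zeta *m J = psi *m dmu -> row_free (col_mx (dmu *m J) dmu).
Proof.
move=> J2 zX zJX zJ; have free := coframe_row_free J2 zX zJX.
rewrite /row_free eqn_leq rank_leq_row /= -{1}(eqP free).
have -> : col_mx zeta (zeta *m J) =
    block_mx (- psi) 0 0 psi *m col_mx (dmu *m J) dmu.
  rewrite mul_block_col !mul0mx addr0 add0r mulNmx mulmxA -zJ -mulmxA J2.
  by rewrite mulmxN mulmx1 opprK.
exact: mxrankM_maxr.
Qed.

(** The bases (zeta^-, zeta^- J_-) and (dmu J_+, dmu) are chosen so that
    the symmetric part of phi, which varies, drops out of the matrix of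
    J_+ - J_-: they satisfy zeta^- J_+ = phi^T dmu + F (dmu J_+) and
    zeta^- = - phi^T (dmu J_+) + F dmu. *)
Lemma rank_diff {Jp Jm : 'M[K]_m} {X} {zp zm dmu : 'M[K]_(n, m)}
    {phi F : 'M[K]_n} :
  m = (n + n)%N -> Jp *m Jp = - 1%:M -> Jm *m Jm = - 1%:M ->
  zp *m X = 1%:M -> zp *m (Jp *m X) = 0 ->
  zm *m X = 1%:M -> zm *m (Jm *m X) = 0 ->
  zp *m Jp = phi^T *m dmu -> zm *m Jm = phi *m dmu -> zm = zp + F *m dmu ->
  \rank (Jp - Jm) =
  \rank (block_mx F (- (phi - phi^T)) (phi - phi^T) F).
Proof.
move=> mE Jp2 Jm2 zpX zpJX zmX zmJX zpJ zmJ zmE.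
have freeZ := coframe_row_free Jm2 zmX zmJX.
have freeD := moment_coframe_row_free Jp2 zpX zpJX zpJ.
have fullZ : row_full (col_mx zm (zm *m Jm)).
  by rewrite /row_full (eqP freeZ) mE.
have zpE : zp = - (phi^T *m (dmu *m Jp)).
  by rewrite mulmxA -zpJ -mulmxA Jp2 mulmxN mulmx1 opprK.
rewrite -(eqmxMfull _ fullZ) -(mxrankMfree _ freeD); congr (\rank _).
rewrite mul_col_mx mul_block_col; congr col_mx.
  rewrite mulmxBr zmJ {1}zmE mulmxDl zpJ -mulmxA mulNmx mulmxBl opprB.
  by rewrite addrAC addrC.
rewrite mulmxBr -[X in _ - X]mulmxA Jm2 mulmxN mulmx1 opprK zmJ zmE zpE.
by rewrite mulmxBl addrA -mulmxA.
Qed.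

End Coframes.

(** By the definition of the adjoint, W J_- = - J_+^T W, so that g is the
    symmetrisation of W J_+ and taming makes it positive definite. *)
Lemma metric_unitmx (R : realType) (m : nat) (W J : 'M[R]_m) :
  W^T = - W -> W \in unitmx ->
  (forall u : 'cV[R]_m, u != 0 -> 0 < (u^T *m W *m (J *m u)) 0 0) ->
  metric_mx W J \in unitmx.
Proof.
move=> Wskew Wu tamed; apply: posdef_unitmx => u u0.
have gE : metric_mx W J = 2^-1 *: (W *m J + (W *m J)^T).
  rewrite /metric_mx /Jminus_mx /flat_mx Wskew mulmxDr mulmxN.
  rewrite !mulmxA mulmxV ?mul1mx; last by rewrite -scaleN1r unitmxZ ?unitrN1.
  by rewrite trmx_mul Wskew mulNmx !mulmxN opprK scaleNr -scalerN opprD opprK.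
have trE : u^T *m ((W *m J)^T *m u) = (u^T *m (W *m J *m u))^T.
  by rewrite !trmx_mul trmxK !mulmxA.
have wE : u^T *m W *m (J *m u) = u^T *m (W *m J *m u) by rewrite !mulmxA.
rewrite gE -scalemxAl -scalemxAr mulmxDl mulmxDr trE -wE.
move: (_ *m (J *m u)) (tamed u u0) => w w_gt0.
by rewrite !mxE -mulr2n -[w 0 0 *+ 2]mulr_natl mulKf ?pnatr_eq0.
Qed.

(** * Type and regularity *)

Lemma open_stratum_nbhs {R : realType} {n : nat} {M : toric_manifold R n}
    {p : M} : open_stratum p -> nbhs p (@open_stratum R n M).
Proof.
move=> pS.
set c := ch (chart_at p); have dp : dom c p := chart_atP p.
have mu_cont : {for fwd c p, continuous (@mu R n M \o Defs.inv c)}.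
  exact: (@mu_smooth _ _ M (chart_at p) 0%N _ (chart_fwd dp)).
have nbS : nbhs (fwd c p)
    ((@mu R n M \o Defs.inv c) @^-1` polytope_interior M).
  apply: mu_cont; apply: open_nbhs_nbhs; split; first exact: open_interior.
  by rewrite /= chart_fwdK.
have nbD : nbhs p (dom c).
  by apply: open_nbhs_nbhs; split=> //; apply: chart_open_dom.
have := chart_fwd_continuous dp nbS.
rewrite nbhs_filterE => nbF.
apply: filterS2 nbD nbF => q dq /=.
by rewrite chart_fwdK.
Qed.

(** The block matrix of [rank_diff] involves phi only through its
    anti-symmetric part, so the moment coordinates of p disappear. *)
Lemma gc_type_corank {R : realType} {n : nat} {M : toric_manifold R n}
    {Jp : tensor_field M 'M[R]_(n.*2)} {phi : 'cV[R]_n -> 'M[R]_n}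
    {F phia : 'M[R]_n} {p : M} :
  GK Jp -> associated_data Jp phi F phia -> open_stratum p ->
  gc_type (J1 Jp) p = (corank (type_mx F phia))%:R.
Proof.
move=> hJ hdata pS; rewrite /gc_type /corank.
set i := chart_at p; have dp : dom (ch i) p := chart_atP p.
have Jp2 := complex_square (GK_plus hJ) dp.
have Jm2 := complex_square (GK_minus hJ) dp.
have gU : metric_mx (@Omega R n M i p) (Jp i p) \in unitmx.
  apply: metric_unitmx; last exact: GK_tamed.
  - exact: symplectic_skew (toric_symplectic M) _ _ dp.
  - exact: symplectic_nondegenerate (toric_symplectic M) _ _ dp.
have [zp [tp [zm [tm [cofp cofm data]]]]] := data_coframes hdata.
have [zpX zpJX _ _] := cofp _ _ dp pS.
have [zmX zmJX _ _] := cofm _ _ dp pS.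
have [zpJ zmJ zmE] := data _ _ dp pS.
have phiE : phi (mu p) - (phi (mu p))^T = 2 *: phia.
  rewrite -(data_phia hdata pS) /asym_part scalerA mulfV ?pnatr_eq0 //.
  by rewrite scale1r.
have typeE : map_mx (real_complex R) F
      - 'i%C *: map_mx (real_complex R) (2 *: phia) = 2 *: type_mx F phia.
  rewrite /type_mx !map_mxZ scalerBr !scalerA rmorphV ?unitfE ?pnatr_eq0 //=.
  by rewrite !rmorph_nat mulfV ?pnatr_eq0 // scale1r mulrC.
have rankE : \rank (poisson_mx (J1 Jp i p)) = (\rank (type_mx F phia)).*2.
  rewrite poisson_J1_mx // mxrank_scale_nz ?oppr_eq0 ?invr_eq0 ?pnatr_eq0 //.
  rewrite mxrankMfree ?row_free_unit ?unitmx_inv //.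
  rewrite (rank_diff _ Jp2 Jm2 zpX zpJX zmX zmJX zpJ zmJ zmE) ?addnn //.
  by rewrite phiE rank_realification typeE mxrank_scale_nz ?pnatr_eq0.
rewrite rankE -muln2 natrM mulfK ?pnatr_eq0 //.
by rewrite natrB ?rank_leq_row.
Qed.

Theorem proposition3p3 (R : realType) (n : nat) (M : toric_manifold R n)
    (Jp : tensor_field M 'M[R]_(n.*2)) (hJ : GK Jp)
    (phi : 'cV[R]_n -> 'M[R]_n) (F phia : 'M[R]_n)
    (hdata : associated_data Jp phi F phia) :
  forall p : M, open_stratum p ->
    regular_point (J1 Jp) p /\
    gc_type (J1 Jp) p = (corank (type_mx F phia))%:R.
Proof.
move=> p pS; have typeE q := @gc_type_corank _ _ _ _ _ _ _ q hJ hdata.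
split; last exact: typeE.
apply: filterS (open_stratum_nbhs pS) => q qS.
by rewrite !typeE.
Qed.
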